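(* Let $M=x_0x_1x_2$ be a triangle split into four sub-triangles $K_1,\dots,K_4$ as in the context, and let $U_M$ be the space of piecewise quartic functions defined there. Then the following degrees of freedom are unisolvent for $U_M$ (i.e. they form a basis of the dual space of $U_M$): (1) the values of $u$, $\nabla u$, $\nabla^2u$ at the three vertices $x_0,x_1,x_2$ of $M$; (2) the values of $\partial_{\bm{n}}u$, $\partial^2_{\bm{tn}}u$, $\partial^2_{\bm{tt}}u$ at the midpoints $m_1,m_2,m_3$ of the three edges of $M$, where $\bm{t}$ and $\bm{n}$ are the tangential and normal vectors of the edge of $M$ containing the midpoint.
   Context: $M=x_0x_1x_2\subset\mathbb{R}^2$ is a (nondegenerate) triangle; $m_1,m_2,m_3$ are the midpoints of the edges $x_1x_2$, $x_0x_1$, $x_0x_2$, respectively. $M$ is divided into $K_1=x_1m_1m_2$, $K_2=x_0m_1m_2$, $K_3=x_0m_1m_3$, $K_4=x_2m_1m_3$, separated by the interior edges $E_1=m_1m_2$, $E_2=m_1x_0$, $E_3=m_1m_3$, with midpoints $d_1,d_2,d_3$. $P_4(K)$ is the space of polynomials of degree at most 4 on $K$. Define $$U_M:=\{u\in L^2(M):\ u|_{K_i}\in P_4(K_i),\ 1\leqslant i\leqslant4;\ u\text{ is }C^2\text{ at }x_0;\ u,\nabla u,\partial^2_{\bm{tt}}u,\partial^2_{\bm{tn}}u\text{ are continuous at }m_i,\ i=1,2,3;\ u\text{ is continuous at }d_i,\ i=1,3\},$$ where at $m_i$ the vectors $\bm{t},\bm{n}$ are the tangential and normal vectors of the edge of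 $M$ containing $m_i$. ''Continuous at a point'' (''$C^2$ at a point'') means that the values (of $u$, $\nabla u$, $\nabla^2 u$) at this point taken from all sub-triangles of $M$ containing the point coincide. *)

(* Defs.v *)
From HB Require Import structures.
From mathcomp Require Import all_boot all_order all_algebra.
From mathcomp Require Import boolp reals.
From mathcomp Require Import mpoly.

Set Implicit Arguments.
Unset Strict Implicit.
Unset Printing Implicit Defensive.

Import Order.TTheory GRing.Theory Num.Theory.

Local Open Scope ring_scope.

(* A space that embeds linearly into a finite-dimensional one is itself
   finite-dimensional; used to give the spline space its vectType structure. *)
Lemma finDim_of_inj (F : fieldType) (V : lmodType F) (W : vectType F)
    (f : {linear V -> W}) :
  injective f -> {k & Vector.axiom k V}.
Proof.
move=> f_inj.
pose P k := `[< exists s : k.-tuple V, free (map f s) >].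
have P0 : exists k, P k by exists 0; apply/asboolP; exists [tuple]; apply: nil_free.
have Pub k : P k -> (k <= \dim {:W})%N.
  move=> /asboolP[s fs]; rewrite -(size_tuple s) -(size_map f).
  by move: fs; rewrite /free => /eqP <-; apply/dimvS/subvf.
case: (ex_maxnP P0 Pub) => k /asboolP Pk kmax.
exists k; have /cid[s fs] := Pk.
have memX v : f v \in <<map_tuple f s>>%VS.
  apply/negPn/negP => fvN; have : P k.+1.
    by apply/asboolP; exists [tuple of v :: s]; rewrite /= free_cons fvN.
  by move/kmax; rewrite ltnn.
pose h v : 'rV[F]_k := \row_i coord (map_tuple f s) i (f v).
pose g (c : 'rV[F]_k) : V := \sum_i c 0 i *: s`_i.
have fgE c : f (g c) = \sum_(i < k) c 0 i *: (map_tuple f s)`_i.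
  rewrite linear_sum; apply: eq_bigr => i _.
  by rewrite linearZ /= (nth_map 0) ?size_tuple.
exists h.
- by move=> a u v; apply/rowP => i; rewrite !mxE !linearP.
- exists g => [v|c].
    apply: f_inj; rewrite fgE [RHS](coord_span (memX v)).
    by apply: eq_bigr => i _; rewrite mxE.
  by apply/rowP => i; rewrite mxE fgE coord_sum_free.
Qed.

Section Calculus.

Variable R : realType.

Definition dird (v : 'rV[R]_2) (p : {mpoly R[2]}) : {mpoly R[2]} :=
  \sum_(i < 2) v 0 i *: p^`M(i).

(* pder [:: v1; ...; vk] p is the iterated directional derivative
   d_v1 ... d_vk p; the empty list stands for p itself. *)
Definition pder (vs : seq 'rV[R]_2) (p : {mpoly R[2]}) : {mpoly R[2]} :=
  foldr dird p vs.

Lemma dird_is_linear v : linear (dird v).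
Proof.
move=> a p q; rewrite /dird scaler_sumr -big_split /=.
by apply: eq_bigr => i _; rewrite linearP scalerDr !scalerA mulrC.
Qed.

HB.instance Definition _ v :=
  GRing.isLinear.Build R {mpoly R[2]} {mpoly R[2]} _ (dird v) (dird_is_linear v).

Lemma pder_is_linear vs : linear (pder vs).
Proof. by move=> a p q; elim: vs => //= v vs ->; rewrite linearP. Qed.

HB.instance Definition _ vs :=
  GRing.isLinear.Build R {mpoly R[2]} {mpoly R[2]} _ (pder vs)
    (pder_is_linear vs).

Definition axis (i : 'I_2) : 'rV[R]_2 := delta_mx 0 i.

Definition jet1 : seq (seq 'rV[R]_2) :=
  [:: [::]; [:: axis 0]; [:: axis 1]].

Definition jet2 : seq (seq 'rV[R]_2) :=
  jet1 ++ [:: [:: axis 0; axis 0]; [:: axis 0; axis 1]; [:: axis 1; axis 1]].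

Definition eval_at (p : {mpoly R[2]}) (a : 'rV[R]_2) : R := p.@[a 0].

Lemma eval_pderP vs a c p q :
  eval_at (pder vs (c *: p + q)) a =
  c * eval_at (pder vs p) a + eval_at (pder vs q) a.
Proof. by rewrite pder_is_linear /eval_at mevalD mevalZ. Qed.

Definition midpoint (a b : 'rV[R]_2) : 'rV[R]_2 := 2^-1 *: (a + b).

Definition triangle (a b c p : 'rV[R]_2) : Prop :=
  exists l0 l1 l2 : R, [/\ 0 <= l0, 0 <= l1, 0 <= l2, l0 + l1 + l2 = 1 &
    p = l0 *: a + l1 *: b + l2 *: c].

Definition dot (v w : 'rV[R]_2) : R := (v *m w^T) 0 0.

(* t is one of the two unit tangents, and n one of the two unit normals, of
   the segment e; no orientation is fixed. *)
Definition edge_frame (e : 'rV[R]_2 * 'rV[R]_2) (t n : 'rV[R]_2) : Prop :=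
  [/\ t \in <[e.2 - e.1]>%VS, dot t t = 1, dot n n = 1 & dot t n = 0].

End Calculus.

Section SplineSpace.

Variables (R : realType) (x0 x1 x2 : 'rV[R]_2) (t n : 'I_3 -> 'rV[R]_2).

(* Indices are shifted by one: edge k carries the midpoint m_(k+1), and
   K k is the sub-triangle K_(k+1). *)
Definition edge (k : 'I_3) : 'rV[R]_2 * 'rV[R]_2 :=
  tnth [tuple (x1, x2); (x0, x1); (x0, x2)] k.

Definition emid (k : 'I_3) : 'rV[R]_2 := midpoint (edge k).1 (edge k).2.

Definition m1 := emid (@Ordinal 3 0 isT).
Definition m2 := emid (@Ordinal 3 1 isT).
Definition m3 := emid (@Ordinal 3 2 isT).

Definition d1 := midpoint m1 m2.
Definition d3 := midpoint m1 m3.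

Definition K (k : 'I_4) : 'rV[R]_2 -> Prop :=
  tnth [tuple triangle x1 m1 m2; triangle x0 m1 m2;
              triangle x0 m1 m3; triangle x2 m1 m3] k.

Definition K1 : 'I_4 := @Ordinal 4 0 isT.
Definition K2 : 'I_4 := @Ordinal 4 1 isT.
Definition K3 : 'I_4 := @Ordinal 4 2 isT.
Definition K4 : 'I_4 := @Ordinal 4 3 isT.

(* A piecewise polynomial, as an element of L^2, is the family of its four
   polynomial restrictions: the sub-triangles have nonempty interior and
   overlap in null sets. *)
Definition pwpoly := {ffun 'I_4 -> {mpoly R[2]}}.

HB.instance Definition _ := GRing.Lmodule.on pwpoly.

Definition continuous_at (vs : seq 'rV[R]_2) (a : 'rV[R]_2) (u : pwpoly) :=
  forall i j : 'I_4, K i a -> K j a ->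
    eval_at (pder vs (u i)) a = eval_at (pder vs (u j)) a.

(* msize p is the total degree of p plus one (and 0 for p = 0). *)
Definition UM_spec (u : pwpoly) : Prop :=
  [/\ forall i, (msize (u i) <= 5)%N,
      {in jet2 R, forall vs, continuous_at vs x0 u},
      forall k, {in jet1 R ++ [:: [:: t k; t k]; [:: t k; n k]], forall vs,
        continuous_at vs (emid k) u},
      continuous_at [::] d1 u & continuous_at [::] d3 u].

Definition UM_pred : {pred pwpoly} := fun u => `[< UM_spec u >].

Lemma continuous_at_lin vs a c u v : continuous_at vs a u ->
  continuous_at vs a v -> continuous_at vs a (c *: u + v).
Proof.
by move=> hu hv i j Ki Kj; rewrite !ffunE !eval_pderP (hu i j) // (hv i j).
Qed.

Lemma UM_predP u : reflect (UM_spec u) (u \in UM_pred).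
Proof. exact: asboolP. Qed.

Lemma UM_submod_closed : submod_closed UM_pred.
Proof.
split=> [|c u v /UM_predP[du u0 um u1 u3] /UM_predP[dv v0 vm v1 v3]].
  by apply/UM_predP; split=> [i|vs _|k vs _||]; rewrite ?ffunE ?msize0 //;
    move=> i j _ _; rewrite !ffunE.
apply/UM_predP; split=> [i|vs vsP|k vs vsP||]; last 4 first.
- by apply: continuous_at_lin; [apply: u0|apply: v0].
- by apply: continuous_at_lin; [apply: um|apply: vm].
- exact: continuous_at_lin.
- exact: continuous_at_lin.
rewrite !ffunE; apply: leq_trans (msizeD_le _ _) _.
by rewrite geq_max dv andbT; apply: leq_trans (msizeZ_le _ _) _.
Qed.

HB.instance Definition _ :=
  GRing.isSubmodClosed.Build R pwpoly UM_pred UM_submod_closed.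

Record UM := MkUM { pieces : pwpoly; _ : pieces \in UM_pred }.

HB.instance Definition _ := [isSub for pieces].
HB.instance Definition _ := [Choice of UM by <:].
HB.instance Definition _ := [SubChoice_isSubLmodule of UM by <:].

Lemma UMP (u : UM) : UM_spec (pieces u).
Proof. by apply/UM_predP; apply: (valP u). Qed.

Definition UM_coefs (u : UM) : {ffun 'I_4 * 'X_{1..2 < 5} -> R^o} :=
  [ffun im : 'I_4 * 'X_{1..2 < 5} => (pieces u im.1)@_(bmnm im.2)].

Lemma UM_coefs_is_linear : linear UM_coefs.
Proof. by move=> c u v; apply/ffunP => im; rewrite !ffunE mcoeffD mcoeffZ. Qed.

HB.instance Definition _ :=
  GRing.isLinear.Build R UM _ _ UM_coefs UM_coefs_is_linear.

Lemma UM_coefs_inj : injective UM_coefs.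
Proof.
move=> u v /ffunP uv; apply/val_inj/ffunP => i; apply/mpolyP => e.
have [du _ _ _ _] := UMP u; have [dv _ _ _ _] := UMP v.
have [e5|e5] := ltnP (mdeg e) 5.
  by have := uv (i, BMultinom e5); rewrite !ffunE.
by rewrite !memN_msupp_eq0 // msize_mdeg_ge //;
  [exact: leq_trans (dv i) e5 | exact: leq_trans (du i) e5].
Qed.

HB.instance Definition _ :=
  Lmodule_hasFinDim.Build R UM (projT2 (finDim_of_inj UM_coefs_inj)).

(* The value of d_vs u at a, read on the i-th sub-triangle. *)
Definition node_val (i : 'I_4) (a : 'rV[R]_2) (vs : seq 'rV[R]_2) (u : UM) :
  R^o := eval_at (pder vs (pieces u i)) a.

Lemma node_val_is_linear i a vs : linear (node_val i a vs).
Proof.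
by move=> c u v; rewrite /node_val /= !ffunE eval_pderP.
Qed.

HB.instance Definition _ i a vs :=
  GRing.isLinear.Build R UM R^o _ (node_val i a vs) (node_val_is_linear i a vs).

(* Each node is paired with one sub-triangle containing it; the conditions
   defining UM make the value independent of that choice. *)
Definition vertex_dofs : seq 'Hom(UM, R^o) :=
  [seq linfun (node_val ia.1 ia.2 vs)
    | ia <- [:: (K2, x0); (K1, x1); (K4, x2)], vs <- jet2 R].

Definition edge_dofs (i : 'I_4) (k : 'I_3) : seq 'Hom(UM, R^o) :=
  [seq linfun (node_val i (emid k) vs)
    | vs <- [:: [:: n k]; [:: t k; n k]; [:: t k; t k]]].

Definition midpoint_dofs : seq 'Hom(UM, R^o) :=
  edge_dofs K1 (@Ordinal 3 0 isT) ++ edge_dofs K1 (@Ordinal 3 1 isT)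
    ++ edge_dofs K3 (@Ordinal 3 2 isT).

Definition dofs : seq 'Hom(UM, R^o) := vertex_dofs ++ midpoint_dofs.

End SplineSpace.

(* Main.v *)
Require Import Defs.
From HB Require Import structures.
From mathcomp Require Import all_boot all_order all_algebra.
From mathcomp Require Import reals.
From mathcomp Require Import mpoly ring lra zify.
Import Order.TTheory GRing.Theory Num.Theory.
Local Open Scope ring_scope.

Set Implicit Arguments.
Unset Strict Implicit.
Unset Printing Implicit Defensive.

(** There are 27 degrees of freedom, and the spline space has dimension at least
60 - 33 = 27: four quartics have 60 coefficients, and the conditions defining
the space amount to 33 linear equations ([dim_UM_ge27]). So it suffices that a
spline u on which all degrees of freedom vanish is zero ([basis_dual],
[dofs_separate]).

On an edge of M, u restricts to two quartics in one variable meeting at the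
midpoint. Each has a triple zero at its end and a zero second derivative at the
midpoint, which forces its slope there, in the direction away from its end, to be
twice its value ([half_edge_slope]). The two directions are opposite while value
and slope are continuous, so both are zero ([edge_midpoint_zero]). Together with
the degrees of freedom, u, its gradient, and the derivative of its gradient along
the edge vanish at each edge midpoint, on every sub-triangle around it ([flat]).

On a sub-triangle with a vertex a of M and a side ab on the boundary of M, where b
is an edge midpoint, u and its normal derivative then have enough zeros on ab for
u to be divisible by the square of the linear form of ab ([double_edge_coef]).
On K2 and K3 the quotient is a quadratic with a double zero at m1 whose polar form
kills the direction of x1 x2, and which is zero at x0, outside the line x1 x2: it
vanishes ([central_zero]). On K1 and K4 two sides lie on the boundary, so u is a
constant times the square of the product of their linear forms. Continuity at d1
and d3 with the zero pieces on K2 and K3 makes the constant zero ([corner_zero]).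

Each of these facts is a small linear system in the Taylor coefficients of a
quartic in an affine frame adapted to the sub-triangle ([frame_taylor]). *)

(** * Polynomials in an affine frame *)

(** The chain rule. Both sides are derivations along composition with [lq], so
it suffices to check them on constants and variables and to pass to products
and sums. *)
Lemma mderiv_comp (R : comNzRingType) (n k : nat) (lq : n.-tuple {mpoly R[k]})
    (j : 'I_k) p :
  (p \mPo lq)^`M(j) = \sum_(i < n) (p^`M(i) \mPo lq) * (tnth lq i)^`M(j).
Proof.
pose P p := (p \mPo lq)^`M(j) =
  \sum_(i < n) (p^`M(i) \mPo lq) * (tnth lq i)^`M(j).
have P1 : P 1.
  rewrite /P comp_mpoly1 -mpolyC1 mderivC big1 // => i _.
  by rewrite mderivC comp_mpoly0 mul0r.
have PX i : P 'X_i.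
  rewrite /P comp_mpolyXU -tnth_nth (bigD1 i) //= mderivX mnm1E eqxx scale1r.
  rewrite -{1}[U_(i)%MM]add0m addmK mpolyX0 comp_mpoly1 mul1r big1 ?addr0 // => l li.
  by rewrite mderivX mnm1E eq_sym (negPf li) scale0r comp_mpoly0 mul0r.
have compM r s : (r * s) \mPo lq = (r \mPo lq) * (s \mPo lq).
  by case: (comp_mpoly_is_multiplicative lq) => ->.
have PM r s : P r -> P s -> P (r * s).
  rewrite /P compM mderivM => -> ->.
  rewrite mulr_suml mulr_sumr -big_split; apply: eq_bigr => i _ /=.
  by rewrite mderivM comp_mpolyD !compM; ring.
have PXm m : P 'X_[m].
  rewrite mpolyXE_id; apply: big_ind => // i _.
  by elim: (m i) => // d IH; rewrite exprS; apply: PM.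
elim/mpolyind: p => [|c m p _ _ IH].
  rewrite comp_mpoly0 !raddf0 big1 // => i _.
  by rewrite mderivC comp_mpoly0 mul0r.
rewrite comp_mpolyD comp_mpolyZ mderivD mderivZ IH PXm.
rewrite scaler_sumr -big_split; apply: eq_bigr => i _ /=.
by rewrite mderivD mderivZ comp_mpolyD comp_mpolyZ mulrDl scalerAl.
Qed.

Section Pullback.
Variable R : realType.
Implicit Types (a b v w : 'rV[R]_2) (p q : {mpoly R[2]}).

Lemma dird_axis (i : 'I_2) q : dird (axis R i) q = q^`M(i).
Proof.
rewrite /dird (bigD1 i) //= mxE !eqxx scale1r big1 ?addr0 // => j ji.
by rewrite mxE (negPf ji) andbF scale0r.
Qed.

(** The affine map sending the point of coordinates (s, r) to
[a + s *: v + r *: w]; composing with it expresses a polynomial in the affine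
frame of origin [a] and axes [v], [w]. *)
Definition frame_map a v w : 2.-tuple {mpoly R[2]} :=
  [tuple (a 0 i)%:MP + v 0 i *: 'X_0 + w 0 i *: 'X_1 | i < 2].

Definition pullback a v w p := p \mPo frame_map a v w.

(** Differentiating along the coordinate axes after the change of frame is
differentiating along the axes of the frame before it, so every condition on a
sub-triangle becomes one on a reference triangle. *)
Lemma pullback_axis a v w p :
  (dird (axis R 0) (pullback a v w p) = pullback a v w (dird v p)) *
  (dird (axis R 1) (pullback a v w p) = pullback a v w (dird w p)).
Proof.
have UU (i : 'I_2) : (U_(i) - U_(i))%MM = 0%MM by rewrite -{1}[U_(i)%MM]add0m addmK.
split; rewrite dird_axis /pullback mderiv_comp /dird raddf_sum; apply: eq_bigr => i _;
  rewrite /= comp_mpolyZ tnth_mktuple !mderivD !mderivZ mderivC !mderivX !mnm1E /=;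
  rewrite !scale1r !scale0r !scaler0 !add0r ?addr0 UU mpolyX0.
  by rewrite -scalerAr mulr1.
by rewrite -scalerAr mulr1.
Qed.

Lemma pullback_eval a v w p x :
  eval_at (pullback a v w p) x = eval_at p (a + x 0 0 *: v + x 0 1 *: w).
Proof.
rewrite /eval_at comp_mpoly_meval; apply: meval_eq => i.
by rewrite tnth_mktuple !mevalD !mevalZ mevalC !mevalXU !mxE !(mulrC (x _ _)).
Qed.

(** An affine substitution cannot raise the degree: each monomial becomes a
product of as many affine factors as its degree. *)
Lemma pullback_msize a v w p d : (msize p <= d)%N -> (msize (pullback a v w p) <= d)%N.
Proof.
move=> pd; rewrite /pullback comp_mpolyE.
apply: (leq_trans (msize_sum _ _ _)); rewrite big_seq; apply/bigmax_leqP_seq => m _ mp.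
apply: leq_trans (msizeZ_le _ _) _; apply: leq_trans (leq_trans (msize_mdeg_lt mp) pd).
have sM (f g : {mpoly R[2]}) k l : (msize f <= k.+1)%N -> (msize g <= l.+1)%N ->
    (msize (f * g) <= (k + l).+1)%N.
  move=> fk gl; have [->|f0] := eqVneq f 0; first by rewrite mul0r msize0.
  have [->|g0] := eqVneq g 0; first by rewrite mulr0 msize0.
  rewrite msizeM // -subn1 leq_subLR; apply: leq_trans (leq_add fk gl) _.
  by rewrite addSn addnS.
have s1 i : (msize (tnth (frame_map a v w) i) <= 2)%N.
  rewrite tnth_mktuple.
  have sX j c : (msize (c *: 'X_j : {mpoly R[2]}) <= 2)%N.
    by apply: leq_trans (msizeZ_le _ _) _; rewrite msizeX mdeg1.
  apply: leq_trans (msizeD_le _ _) _; rewrite geq_max sX andbT.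
  apply: leq_trans (msizeD_le _ _) _; rewrite geq_max sX andbT.
  by rewrite msizeC; case: eqP.
rewrite mdegE; apply: (big_ind2 (fun f k => msize f <= k.+1)%N).
- by rewrite msize1.
- by move=> *; apply: sM.
- move=> i _; elim: (m i) => [|e IH]; first by rewrite msize1.
  by rewrite exprS; apply: (sM _ _ 1%N).
Qed.

End Pullback.

(** * Taylor coefficients of plane quartics *)

Ltac at01 :=
  rewrite ?(expr0, expr1n, expr0n) /= ?(mulr0, mulr1, add0r, addr0, mulr1n).

Section TaylorCoefficients.
Variable R : realType.
Implicit Types (a b v w : 'rV[R]_2) (p q : {mpoly R[2]}).

Lemma pullback_comp a v w b v' w' p :
  pullback b v' w' (pullback a v w p) =
  pullback (a + b 0 0 *: v + b 0 1 *: w) (v' 0 0 *: v + v' 0 1 *: w)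
    (w' 0 0 *: v + w' 0 1 *: w) p.
Proof.
have [compM comp1] := comp_mpoly_is_multiplicative (frame_map b v' w').
rewrite /pullback [in LHS](comp_mpolyE p) raddf_sum [RHS]comp_mpolyE.
apply: eq_bigr => m _; rewrite /= comp_mpolyZ; congr (_ *: _).
rewrite (big_morph _ compM comp1); apply: eq_bigr => i _.
transitivity ((tnth (frame_map a v w) i \mPo frame_map b v' w') ^+ m i).
  by elim: (m i) => [|k IH]; rewrite ?expr0 ?comp1 // !exprS compM IH.
congr (_ ^+ _); rewrite !tnth_mktuple !comp_mpolyD !comp_mpolyZ comp_mpolyC.
rewrite !comp_mpolyXU -!tnth_nth !tnth_mktuple !mxE.
by rewrite !mpolyCD !mpolyCM -!mul_mpolyC !mpolyCD !mpolyCM; ring.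
Qed.

Lemma ord2P (i : 'I_2) : i = 0 \/ i = 1.
Proof. by case: i => [[|[|[]]]] // i2; [left|right]; apply: val_inj. Qed.

Lemma pullback_id p : pullback 0 (axis R 0) (axis R 1) p = p.
Proof.
rewrite -[RHS]comp_mpoly_id; congr comp_mpoly; apply: eq_from_tnth => i.
rewrite !tnth_mktuple !mxE mpolyC0 add0r /=.
by have [->|->] := ord2P i; rewrite /= ?scale1r ?scale0r ?addr0 ?add0r.
Qed.

(** The inverse change of frame is again affine: its origin and axes are the
coordinates, in the basis [v], [w], of [- a] and of the coordinate axes. *)
Lemma pullback_inj a v w : free [:: v; w] -> injective (pullback a v w).
Proof.
move=> vw.
pose f i := coord [tuple v; w] i.
have fE y : y = f 0 y *: v + f 1 y *: w.
  have full : <<[:: v; w]>>%VS = fullv.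
    apply/eqP; rewrite eqEdim subvf /=; move: vw; rewrite /free => /eqP ->.
    by rewrite dimvf.
  have yX : y \in <<[tuple v; w]>>%VS by rewrite full memvf.
  rewrite [LHS](coord_span yX) !big_ord_recl big_ord0 addr0 /=.
  by congr (_ + coord _ _ _ *: _); apply: val_inj.
pose g y : 'rV[R]_2 := \row_i f i y.
apply: (can_inj (g := pullback (g (- a)) (g (axis R 0)) (g (axis R 1)))) => p.
by rewrite pullback_comp !mxE -addrA -!fE subrr pullback_id.
Qed.

Definition bidegree (i j : nat) : 'X_{1..2} := (U_(0%R) *+ i + U_(1%R) *+ j)%MM.

Lemma bidegreeE i j : (bidegree i j 0%R = i) * (bidegree i j 1%R = j).
Proof. by rewrite !mnmDE !mulmnE !mnm1E /= mul1n mul0n mul1n addn0. Qed.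

Lemma bidegree_eta (m : 'X_{1..2}) : bidegree (m 0%R) (m 1%R) = m.
Proof.
by apply/mnmP => i; have [->|->] := ord2P i; rewrite bidegreeE.
Qed.

Lemma mdeg_bidegree i j : mdeg (bidegree i j) = (i + j)%N.
Proof. by rewrite mdegD !mdegMn !mdeg1 !mul1n. Qed.

Lemma msize_le_coef p d :
  (forall m, (d <= mdeg m)%N -> p@_m = 0) -> (msize p <= d)%N.
Proof.
move=> h; rewrite msizeE; apply/bigmax_leqP_seq => m mp _.
by rewrite ltnNge; apply: contraTN mp => /h/eqP; rewrite mcoeff_msupp => ->.
Qed.

Lemma msize_mderiv i p d : (msize p <= d.+1)%N -> (msize p^`M(i) <= d)%N.
Proof.
move=> pd; apply: msize_le_coef => m dm; rewrite mcoeff_deriv memN_msupp_eq0 ?mul0rn //.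
by apply/msize_mdeg_ge/(leq_trans pd); rewrite mdegD mdeg1 addn1.
Qed.

(** A bivariate polynomial of total degree less than [d], with its coefficients
given as an arbitrary family: the linear systems below are solved for these
coefficients once they no longer mention the polynomial they come from. *)
Definition taylor (d : nat) (c : nat -> nat -> R) (s r : R) : R :=
  \sum_(0 <= i < d) \sum_(0 <= j < d - i) c i j * s ^+ i * r ^+ j.

Lemma taylor_eval p d (x : 'rV[R]_2) : (msize p <= d)%N ->
  eval_at p x = taylor d (fun i j => p@_(bidegree i j)) (x 0 0) (x 0 1).
Proof.
move=> pd.
have pE : p = \sum_(0 <= i < d) \sum_(0 <= j < d - i) p@_(bidegree i j) *: 'X_[bidegree i j].
  apply/mpolyP => m; rewrite raddf_sum /=.
  transitivity (\sum_(0 <= i < d | i == m 0%R) \sum_(0 <= j < d - i | j == m 1%R) p@_m).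
    rewrite big_nat1_eq big_nat1_eq /= ltn_subRL.
    have [dm|dm] := ltnP (m 0%R + m 1%R) d.
      by rewrite (leq_ltn_trans (leq_addr _ _) dm).
    rewrite memN_msupp_eq0 ?if_same //; apply: msize_mdeg_ge; apply: leq_trans pd _.
    by rewrite -(bidegree_eta m) mdeg_bidegree.
  have bidegree_eq i j : (bidegree i j == m) = (i == m 0%R) && (j == m 1%R).
    apply/eqP/andP => [<-|[/eqP -> /eqP ->]]; first by rewrite !bidegreeE.
    exact: bidegree_eta.
  rewrite big_mkcond; apply: eq_bigr => i _; rewrite raddf_sum /=.
  under [RHS]eq_bigr do rewrite mcoeffZ mcoeffX bidegree_eq.
  have [->|_] := eqVneq i; last by rewrite big1 // => j _; rewrite mulr0.
  rewrite big_mkcond; apply: eq_bigr => j _.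
  by have [->|_] := eqVneq j; rewrite ?mulr0 ?mulr1 ?bidegree_eta.
rewrite [in LHS]pE /eval_at /taylor raddf_sum /=; apply: eq_bigr => i _.
rewrite raddf_sum /=; apply: eq_bigr => j _.
rewrite mevalZ mevalX big_ord_recl big_ord1 -mulrA; congr (_ * (_ * _)).
  by congr (_ ^+ _); exact: (bidegreeE i j).1.
have -> : lift ord0 ord0 = 1%R :> 'I_2 by apply: val_inj.
by congr (_ ^+ _); exact: (bidegreeE i j).2.
Qed.

Lemma dird2E v w p : dird v (dird w p) =
  \sum_(i < 2) \sum_(j < 2) (v 0 i * w 0 j) *: p^`M(j)^`M(i).
Proof.
rewrite [RHS]exchange_big [in LHS]/(dird w p) linear_sum; apply: eq_bigr => j _.
rewrite linearZ /= scaler_sumr; apply: eq_bigr => i _.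
by rewrite scalerA mulrC.
Qed.

Lemma dirdC v w p : dird v (dird w p) = dird w (dird v p).
Proof.
rewrite !dird2E exchange_big; apply: eq_bigr => i _; apply: eq_bigr => j _.
by rewrite mulrC mderiv_comm.
Qed.

Lemma mcoeff_dird_axis p i j :
  ((dird (axis R 0) p)@_(bidegree i j) = p@_(bidegree i.+1 j) *+ i.+1) *
  ((dird (axis R 1) p)@_(bidegree i j) = p@_(bidegree i j.+1) *+ j.+1).
Proof.
split; rewrite dird_axis mcoeff_deriv (bidegreeE i j); congr (_@__ *+ _); apply/mnmP => k;
  have [->|->] := ord2P k; rewrite mnmDE mnm1E !bidegreeE /=; lia.
Qed.

Lemma msize_dird v p d : (msize p <= d.+1)%N -> (msize (dird v p) <= d)%N.
Proof.
move=> pd; apply: leq_trans (msize_sum _ _ _) _; apply/bigmax_leqP => i _.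
by apply: leq_trans (msizeZ_le _ _) _; apply: msize_mderiv.
Qed.

(** The Taylor coefficients of [p] at [a] along [v] and [w]. *)
Definition tcoef a v w p (i j : nat) : R := (pullback a v w p)@_(bidegree i j).

Lemma tcoef_high a v w p i j :
  (msize p <= 5)%N -> (5 <= i + j)%N -> tcoef a v w p i j = 0.
Proof.
move=> p5 ij; rewrite /tcoef memN_msupp_eq0 // msize_mdeg_ge // mdeg_bidegree.
exact: leq_trans (pullback_msize _ _ _ p5) ij.
Qed.

Lemma tcoef_eq0 a v w p : free [:: v; w] ->
  (forall i j, tcoef a v w p i j = 0) -> p = 0.
Proof.
move=> vw c0; apply: (@pullback_inj a v w vw p 0).
by rewrite [RHS]comp_mpoly0; apply/mpolyP => m; rewrite mcoeff0 -(bidegree_eta m); apply: c0.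
Qed.

(** All derivatives of order at most two of a quartic, at the point of
coordinates (s, r) of a frame, as linear forms in its Taylor coefficients in
that frame. *)
Lemma frame_taylor a v w p s r (y := a + s *: v + r *: w) (c := tcoef a v w p) :
  (msize p <= 5)%N ->
  [/\ eval_at p y = taylor 5 c s r,
      eval_at (dird v p) y = taylor 4 (fun i j => c i.+1 j *+ i.+1) s r
    & eval_at (dird w p) y = taylor 4 (fun i j => c i j.+1 *+ j.+1) s r] /\
  [/\ eval_at (dird v (dird v p)) y =
        taylor 3 (fun i j => c i.+2 j *+ i.+2 *+ i.+1) s r,
      eval_at (dird v (dird w p)) y =
        taylor 3 (fun i j => c i.+1 j.+1 *+ j.+1 *+ i.+1) s r
    & eval_at (dird w (dird w p)) y =
        taylor 3 (fun i j => c i j.+2 *+ j.+2 *+ j.+1) s r].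
Proof.
move=> p5; pose q := pullback a v w p.
have q5 : (msize q <= 5)%N by apply: pullback_msize.
have E f : eval_at f y =
    eval_at (pullback a v w f) (s *: axis R 0 + r *: axis R 1).
  by rewrite pullback_eval !mxE /= !mulr1 !mulr0 addr0 add0r.
have T d f c' : (msize f <= d)%N -> (forall i j, f@_(bidegree i j) = c' i j) ->
    eval_at f (s *: axis R 0 + r *: axis R 1) = taylor d c' s r.
  move=> fd fc; rewrite (taylor_eval _ fd) !mxE /= !mulr1 !mulr0 addr0 add0r.
  by apply: eq_bigr => i _; apply: eq_bigr => j _; rewrite fc.
split; split; rewrite E -?pullback_axis -/q; apply: T => [|i j];
  by rewrite ?msize_dird ?mcoeff_dird_axis.
Qed.

(** The vertex conditions, quantified over all directions so that they can be
read in any frame. *)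
Definition zero_jet2 p a := forall v w,
  [/\ eval_at p a = 0, eval_at (dird v p) a = 0
    & eval_at (dird v (dird w p)) a = 0].

(** The midpoint conditions along an edge of direction [e]. Among the derivatives
of order at most two, only the second normal derivative is left free. *)
Definition flat p a e := forall w,
  [/\ eval_at p a = 0, eval_at (dird w p) a = 0
    & eval_at (dird e (dird w p)) a = 0].

(** On the half edge from [a] to [a + e], the trace is s^3 (k + l s) with s in
[0, 1], because of the zero 2-jet at s = 0; the vanishing second derivative at
s = 1 forces k = - 2 l, and then the trace has value - l and slope - 2 l. *)
Lemma half_edge_slope p a e : (msize p <= 5)%N -> zero_jet2 p a ->
  eval_at (dird e (dird e p)) (a + e) = 0 ->
  eval_at (dird e p) (a + e) = 2 * eval_at p (a + e).
Proof.
move=> p5 pa pee; have [p0 p1 p2] := pa e e; move: pee.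
(* The edge is one-dimensional, so the second axis of the frame is taken to
   be 0. *)
have := frame_taylor a e 0 1 0 p5; have := frame_taylor a e 0 0 0 p5.
rewrite !scaler0 !scale0r scale1r !addr0 p0 p1 p2; move: (tcoef _ _ _ p) => k.
rewrite /taylor unlock /=; at01.
by move=> [[c0 c1 _] [c2 _ _]] [[-> -> _] [-> _ _]]; lra.
Qed.

End TaylorCoefficients.

(** * Quartics vanishing on a sub-triangle *)

Section QuarticVanishing.
Variable R : realType.
Implicit Types (a b v w : 'rV[R]_2) (p q : {mpoly R[2]}).

Lemma dird_linl x y v w p :
  dird (x *: v + y *: w) p = x *: dird v p + y *: dird w p.
Proof.
rewrite /dird !scaler_sumr -big_split; apply: eq_bigr => i _.
by rewrite !mxE /= scalerDl !scalerA.
Qed.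

Lemma eval_dird_linl x y v w p a : eval_at (dird (x *: v + y *: w) p) a =
  x * eval_at (dird v p) a + y * eval_at (dird w p) a.
Proof. by rewrite dird_linl /eval_at mevalD !mevalZ. Qed.

(** A quartic with a zero 2-jet at [a] that is flat at [b] is divisible by the
square of the linear form vanishing on the line ab. Indeed the trace and the
derivative along [w] on this line are univariate, of degree at most 4 and 3; the
former has a triple zero at [a] and a double one at [b], the latter a double
zero at each. The zero 2-jet also kills the second derivative along [w] at [a]. *)
Lemma double_edge_coef p a b w (k := tcoef a (b - a) w p) :
  (msize p <= 5)%N -> zero_jet2 p a -> flat p b (b - a) ->
  [/\ forall i, k i 0%N = 0, forall i, k i 1%N = 0 & k 0%N 2%N = 0].
Proof.
move=> p5; pose v := b - a; rewrite -/v => pa pb.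
have [p0 pv pvv] := pa v v; have [_ _ pvw] := pa v w; have [_ pw pww] := pa w w.
have [q0 qv qvv] := pb v; have [_ qw qvw] := pb w.
have high i j : (5 <= i + j)%N -> k i j = 0 by apply: tcoef_high.
have := frame_taylor a v w 1 0 p5; have := frame_taylor a v w 0 0 p5.
have -> : a + 0 *: v + 0 *: w = a by rewrite !scale0r !addr0.
have -> : a + 1 *: v + 0 *: w = b by rewrite scale0r scale1r addr0 subrKC.
rewrite p0 pv pw pvv pvw pww q0 qv qw qvw -/k; clearbody k.
rewrite /taylor unlock /=; at01.
move=> -[[a0 av aw] [avv avw aww]] [[b0 bv bw] [_ bvw _]].
rewrite -a0 -av -aw in b0 bv bw bvw.
split=> [i|i|]; last by lra.
  by (do 5?[case: i => [|i]]); last (by rewrite high); lra.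
by (do 4?[case: i => [|i]]); last (by rewrite high // addn1); lra.
Qed.

(** The two sides ab and ac each contribute a double factor, so [p] is a multiple
of the square of the product of their linear forms; the value at the midpoint of
bc, where that product is nonzero, determines the multiple. *)
Lemma corner_zero p a b c :
  (msize p <= 5)%N -> free [:: b - a; c - a] ->
  zero_jet2 p a -> flat p b (b - a) -> flat p c (c - a) ->
  eval_at p (midpoint b c) = 0 -> p = 0.
Proof.
move=> p5 vw pa pb pc pm; apply: (@tcoef_eq0 _ a _ _ p vw).
have [k0 k1 k02] := double_edge_coef (c - a) p5 pa pb.
have high i j : (5 <= i + j)%N -> tcoef a (b - a) (c - a) p i j = 0.
  exact: tcoef_high.
have [q0 qv qwv] := pc (b - a); have [_ qw _] := pc (c - a).
have := frame_taylor a (b - a) (c - a) 2^-1 2^-1 p5.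
have := frame_taylor a (b - a) (c - a) 0 1 p5.
have -> : a + 0 *: (b - a) + 1 *: (c - a) = c.
  by rewrite scale0r scale1r addr0 subrKC.
have -> : a + 2^-1 *: (b - a) + 2^-1 *: (c - a) = midpoint b c.
  by apply/rowP => i; rewrite !mxE; field.
rewrite q0 qv qw dirdC qwv pm.
move: (tcoef _ _ _ p) k0 k1 k02 high => k k0 k1 k02 high.
rewrite /taylor unlock /= !k0 !k1 k02; at01.
move=> -[[c0 cv cw] [_ cvw _]] [[cm _ _] _].
have [k03 k04 k12 k13] :
    [/\ k 0%N 3%N = 0, k 0%N 4%N = 0, k 1%N 2%N = 0 & k 1%N 3%N = 0].
  by split; lra.
have k22 : k 2%N 2%N = 0 by rewrite k03 k04 k12 k13 in cm; lra.
move=> i j; have [/high //|] := leqP 5 (i + j).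
by (do 5?[case: j => [|j]]) => //; (do 5?[case: i => [|i]]).
Qed.

(** By [double_edge_coef], [p] is the square of the linear form of ab times a
quadratic r, with r = 0 at [a]. At [c], where the form is nonzero, r has a double
zero, so it is a quadratic form in the displacement from [c], and its polar form
vanishes against the flat direction. Hence r is a multiple of the square of a
linear form vanishing on the line through [c] of that direction. This line
misses [a] because [x != 0], and r = 0 at [a] gives r = 0. *)
Lemma central_zero p a b c x y :
  (msize p <= 5)%N -> free [:: b - a; c - a] -> x != 0 ->
  zero_jet2 p a -> flat p b (b - a) -> flat p c (x *: (b - a) + y *: (c - a)) ->
  p = 0.
Proof.
move=> p5 vw x0 pa pb pc; apply: (@tcoef_eq0 _ a _ _ p vw).
have [k0 k1 k02] := double_edge_coef (c - a) p5 pa pb.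
have high i j : (5 <= i + j)%N -> tcoef a (b - a) (c - a) p i j = 0.
  exact: tcoef_high.
have [q0 qv qev] := pc (b - a); have [_ qw qew] := pc (c - a).
have := frame_taylor a (b - a) (c - a) 0 1 p5.
have -> : a + 0 *: (b - a) + 1 *: (c - a) = c.
  by rewrite scale0r scale1r addr0 subrKC.
move: (tcoef _ _ _ p) k0 k1 k02 high => k k0 k1 k02 high.
rewrite q0 qv qw /taylor unlock /= !k0 !k1 k02; at01.
move=> -[[c0 cv cw] [cvv cvw cww]].
have [k03 k04] : k 0%N 3%N = 0 /\ k 0%N 4%N = 0 by split; lra.
(* The second derivative along c - a at c only involves k02, k03 and k04. *)
have vwc : eval_at (dird (b - a) (dird (c - a) p)) c = 0.
  move/eqP: qew; rewrite eval_dird_linl cww k03 k04 !mul0rn !addr0 mulr0 addr0.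
  by rewrite mulf_eq0 (negPf x0) => /eqP.
have vvc : eval_at (dird (b - a) (dird (b - a) p)) c = 0.
  move/eqP: qev; rewrite eval_dird_linl [dird (c - a) _]dirdC vwc mulr0 addr0.
  by rewrite mulf_eq0 (negPf x0) => /eqP.
have [k12 k13 k22] : [/\ k 1%N 2%N = 0, k 1%N 3%N = 0 & k 2%N 2%N = 0].
  by rewrite vwc vvc in cvv cvw; split; lra.
move=> i j; have [/high //|] := leqP 5 (i + j).
by (do 5?[case: j => [|j]]) => //; (do 5?[case: i => [|i]]).
Qed.
End QuarticVanishing.

(** * Counting linear forms *)

Section Dual.
Variables (F : fieldType) (V : vectType F).
Implicit Types s : seq 'Hom(V, F^o).

Lemma dim_dual : \dim {:'Hom(V, F^o)} = \dim {:V}.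
Proof. by rewrite !dimvf; exact: muln1. Qed.

Definition joint_eval s (u : V) : {ffun 'I_(size s) -> F^o} :=
  [ffun i : 'I_(size s) => s`_i u].

Lemma joint_eval_is_linear s : linear (joint_eval s).
Proof. by move=> a u v; apply/ffunP => i; rewrite !ffunE linearP. Qed.

HB.instance Definition _ s :=
  GRing.isLinear.Build F V {ffun 'I_(size s) -> F^o} _ (joint_eval s)
    (joint_eval_is_linear s).

(** A family of forms without common zero is, taken jointly, an injective map;
composing any form with a left inverse of it writes that form as a combination
of the family. *)
Lemma span_dual s :
  (forall u, (forall phi, phi \in s -> phi u = 0) -> u = 0) ->
  <<s>>%VS = fullv.
Proof.
move=> s0; apply/eqP; rewrite eqEsubv subvf /=; apply/subvP => phi _.
pose f := linfun (joint_eval s).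
have kf : lker f == 0%VS.
  apply/eqP/vspaceP => u; rewrite memv0; apply/idP/eqP => [|->]; last exact: mem0v.
  rewrite memv_ker lfunE /= => /eqP/ffunP fu; apply: s0 => psi /(nthP 0)[i si <-].
  by have := fu (Ordinal si); rewrite !ffunE.
have -> : phi = \sum_(i < size s) phi ((f^-1)%VF [ffun j => (i == j)%:R]) *: s`_i.
  apply/lfunP => u; rewrite sum_lfunE -{1}[u](lker0_lfunK kf).
  have {1}-> : f u = \sum_(i < size s) s`_i u *: [ffun j => (i == j)%:R].
    apply/ffunP => j; rewrite sum_ffunE lfunE /= ffunE (bigD1 j) //= !ffunE eqxx.
    by rewrite big1 ?addr0 ?[_ *: _]mulr1 // => i ij; rewrite !ffunE (negPf ij) scaler0.
  rewrite !linear_sum; apply: eq_bigr => i _.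
  by rewrite !linearZ lfunE /= [LHS]mulrC.
by apply: memv_suml => i _; apply/memvZ/memv_span/mem_nth.
Qed.

Lemma dim_common_kernel s :
  (\dim {:V} <= \dim (\bigcap_(phi <- s) lker phi)%VS + size s)%N.
Proof.
elim: s => [|phi s IH]; first by rewrite big_nil addn0.
rewrite big_cons capvC /= addnS; set U := (\bigcap_(psi <- s) _)%VS in IH *.
have img1 : (\dim (phi @: U) <= 1)%N by rewrite (leq_trans (dimvS (subvf _))) ?dimvf.
by have := limg_ker_dim phi U; lia.
Qed.

(** Unisolvence from injectivity and a count of dimensions. *)
Lemma basis_dual s : (size s <= \dim {:V})%N ->
  (forall u, (forall phi, phi \in s -> phi u = 0) -> u = 0) ->
  basis_of {:'Hom(V, F^o)}%VS s.
Proof. by move=> sV /span_dual sE; rewrite basisEdim sE subvv dim_dual. Qed.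
End Dual.

Lemma card_bmultinom_quartic : (15 <= #|{: 'X_{1..2 < 5}}|)%N.
Proof.
pose A := [set x : 'I_5 * 'I_5 | (x.1 + x.2 < 5)%N].
have <- : #|A| = 15%N.
  rewrite cardsE -sum1_card big_mkcond.
  rewrite -(pair_bigA _ (fun i j : 'I_5 => if (i + j < 5)%N then 1 else 0)%N) /=.
  by rewrite !big_ord_recl !big_ord0.
pose f (x : 'I_5 * 'I_5) : 'X_{1..2 < 5} := insubd bm0 (bidegree x.1 x.2).
rewrite -(card_in_imset (f := f)) ?max_card // => x y; rewrite !inE => x5 y5.
move/(congr1 val); rewrite /f /= !val_insubd !mdeg_bidegree x5 y5.
case: x y {x5 y5} => [i j] [i' j'] /= e.
have [ei ej] := bidegreeE i j; rewrite e !bidegreeE in ei ej.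
by congr (_, _); apply: val_inj.
Qed.

(** * The equations of the spline space *)

Section Dimension.
Variables (R : realType) (x0 x1 x2 : 'rV[R]_2) (t n : 'I_3 -> 'rV[R]_2).

Let W := {ffun 'I_4 * 'X_{1..2 < 5} -> R^o}.

Definition piece_of (c : W) (i : 'I_4) : {mpoly R[2]} :=
  \sum_(b : 'X_{1..2 < 5}) c (i, b) *: 'X_[b].

Lemma piece_of_is_linear i : linear (piece_of ^~ i).
Proof.
move=> a c c'; rewrite /piece_of scaler_sumr -big_split; apply: eq_bigr => b _.
by rewrite !ffunE scalerDl scalerA.
Qed.

Lemma msize_piece_of c i : (msize (piece_of c i) <= 5)%N.
Proof.
apply: leq_trans (msize_sum _ _ _) _; apply/bigmax_leqP => b _.
by apply: leq_trans (msizeZ_le _ _) _; rewrite msizeX bmdeg.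
Qed.

Lemma mcoeff_piece_of c i (b : 'X_{1..2 < 5}) : (piece_of c i)@_b = c (i, b).
Proof.
rewrite raddf_sum (bigD1 b) //= mcoeffZ mcoeffX eqxx mulr1 big1 ?addr0 // => b' bb'.
by rewrite mcoeffZ mcoeffX (inj_eq val_inj) (negPf bb') mulr0.
Qed.

(** The obstruction to continuity between two pieces. *)
Definition jump (i j : 'I_4) a vs (c : W) : R^o :=
  eval_at (pder vs (piece_of c i)) a - eval_at (pder vs (piece_of c j)) a.

Lemma jump_is_linear i j a vs : linear (jump i j a vs).
Proof.
move=> e c c'; rewrite /jump !piece_of_is_linear !eval_pderP.
by rewrite [_ *: _]mulrBr opprD addrACA.
Qed.

HB.instance Definition _ i j a vs :=
  GRing.isLinear.Build R W R^o _ (jump i j a vs) (jump_is_linear i j a vs).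

Definition jumps (a : 'rV[R]_2) (pairs : seq ('I_4 * 'I_4)) vss :
    seq 'Hom(W, R^o) :=
  [seq linfun (jump ij.1 ij.2 a vs) | ij <- pairs, vs <- vss].

Lemma size_jumps a pairs vss :
  size (jumps a pairs vss) = (size pairs * size vss)%N.
Proof. exact: size_allpairs. Qed.

Let em := emid x0 x1 x2.
Let edge_jet k := jet1 R ++ [:: [:: t k; t k]; [:: t k; n k]].

(** A spanning set of the conditions defining the spline space: at each node one
piece is compared to the others that meet there, which gives
6 + 15 + 5 + 5 + 1 + 1 = 33 equations. *)
Definition constraints : seq 'Hom(W, R^o) :=
  jumps x0 [:: (K2, K3)] (jet2 R) ++
  jumps (em 0) [:: (K1, K2); (K1, K3); (K1, K4)] (edge_jet 0) ++
  jumps (em 1) [:: (K1, K2)] (edge_jet 1) ++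
  jumps (em 2) [:: (K3, K4)] (edge_jet 2) ++
  jumps (d1 x0 x1 x2) [:: (K1, K2)] [:: [::]] ++
  jumps (d3 x0 x1 x2) [:: (K3, K4)] [:: [::]].

Lemma size_constraints : size constraints = 33%N.
Proof.
rewrite /constraints; do 5!rewrite size_cat size_jumps.
by rewrite size_jumps.
Qed.

Lemma jumpsP c a pairs vss :
  (forall phi, phi \in jumps a pairs vss -> phi c = 0) ->
  forall ij vs, ij \in pairs -> vs \in vss ->
    eval_at (pder vs (piece_of c ij.1)) a =
    eval_at (pder vs (piece_of c ij.2)) a.
Proof.
move=> c0 ij vs ijp vsp; apply/eqP; rewrite -subr_eq0; apply/eqP.
have := c0 (linfun (jump ij.1 ij.2 a vs)); rewrite lfunE; apply.
by apply/allpairsP; exists (ij, vs).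
Qed.

End Dimension.

(** * Incidences and the dimension of the spline space *)

Section Geometry.
Variable R : realType.
Implicit Types a b c p x y : 'rV[R]_2.

Lemma triangle_1 a b c : triangle a b c a.
Proof. by exists 1, 0, 0; rewrite !scale0r scale1r !addr0 ler01 lexx. Qed.

Lemma triangle_2 a b c : triangle a b c b.
Proof. by exists 0, 1, 0; rewrite !scale0r scale1r !addr0 !add0r ler01 lexx. Qed.

Lemma triangle_3 a b c : triangle a b c c.
Proof. by exists 0, 0, 1; rewrite !scale0r scale1r !addr0 !add0r ler01 lexx. Qed.

Lemma triangle_mid23 a b c : triangle a b c (midpoint b c).
Proof.
exists 0, 2^-1, 2^-1; split; [lra|lra|lra|lra|].
by rewrite scale0r add0r /midpoint scalerDr.
Qed.

(** Convexity, used to separate a node from the sub-triangles that miss it by a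
linear form whose values at their vertices are known. *)
Lemma triangle_ge (f g : {scalar 'rV[R]_2}) (k u v : R) a b c p :
  triangle a b c p ->
  k <= u * f a + v * g a -> k <= u * f b + v * g b -> k <= u * f c + v * g c ->
  k <= u * f p + v * g p.
Proof.
move=> [l0 [l1 [l2 [l0p l1p l2p ls ->]]]] ka kb kc.
by rewrite !linearD !linearZ /=; nra.
Qed.

Lemma K_cases (i : 'I_4) : [\/ i = K1, i = K2, i = K3 | i = K4].
Proof.
by case: i => [[|[|[|[|]]]]] // i4;
  [apply: Or41|apply: Or42|apply: Or43|apply: Or44]; apply: val_inj.
Qed.

Variables (x0 x1 x2 : 'rV[R]_2).
Hypothesis hM : free [:: x1 - x0; x2 - x0].

(** The linear parts of the barycentric coordinates attached to [x1] and [x2]. *)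
Lemma barycentric_forms : exists f g : {scalar 'rV[R]_2},
  [/\ f x1 = f x0 + 1, f x2 = f x0, g x1 = g x0 & g x2 = g x0 + 1].
Proof.
pose X : 2.-tuple 'rV[R]_2 := [tuple x1 - x0; x2 - x0].
have E i j := coord_free i j (hM : free X).
exists (coord X 0), (coord X 1).
have := (E 0 0, E 1 0, E 0 1, E 1 1).
by rewrite /= !linearB /= => -[[[e00 e01] e10] e11]; split; lra.
Qed.

Lemma nodes_in_K :
  [/\ {in [:: K2; K3], forall i, K x0 x1 x2 i x0},
    forall i, K x0 x1 x2 i (emid x0 x1 x2 0),
    {in [:: K1; K2], forall i, K x0 x1 x2 i (emid x0 x1 x2 1)} &
    {in [:: K3; K4], forall i, K x0 x1 x2 i (emid x0 x1 x2 2)}] /\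
  [/\ {in [:: K1; K2], forall i, K x0 x1 x2 i (d1 x0 x1 x2)} &
    {in [:: K3; K4], forall i, K x0 x1 x2 i (d3 x0 x1 x2)}].
Proof.
split; split=> i; rewrite ?inE; try (by move=> /orP[]/eqP ->;
  first [exact: triangle_1|exact: triangle_2
        |exact: triangle_3|exact: triangle_mid23]).
by case: i => [[|[|[|[|]]]]] // ?;
  first [exact: triangle_1|exact: triangle_2
        |exact: triangle_3|exact: triangle_mid23].
Qed.

(** The line through [x0] and [m1] separates [K1], [K2] from [K3], [K4]; [x0] is
separated from [K1] and [K4] by a barycentric coordinate, at least one half
there. *)
Lemma node_K_only (i : 'I_4) :
  [/\ K x0 x1 x2 i x0 -> i \in [:: K2; K3],
      K x0 x1 x2 i (emid x0 x1 x2 1) -> i \in [:: K1; K2]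
    & K x0 x1 x2 i (emid x0 x1 x2 2) -> i \in [:: K3; K4]] /\
  [/\ K x0 x1 x2 i (d1 x0 x1 x2) -> i \in [:: K1; K2]
    & K x0 x1 x2 i (d3 x0 x1 x2) -> i \in [:: K3; K4]].
Proof.
have [f [g [f1 f2 g1 g2]]] := barycentric_forms.
have midE (h : {scalar 'rV[R]_2}) y z : h (midpoint y z) = (h y + h z) / 2.
  by rewrite linearZ linearD /= mulrC.
have mE := (midE f, midE g, f1, f2, g1, g2).
split; split; rewrite !inE; case: (K_cases i) => -> // iK; exfalso.
- by have := @triangle_ge f g (f x0 + 2^-1) 1 0 _ _ _ _ iK; rewrite !mE; lra.
- by have := @triangle_ge f g (g x0 + 2^-1) 0 1 _ _ _ _ iK; rewrite !mE; lra.
- by have := @triangle_ge f g (g x0 - f x0) (- 1) 1 _ _ _ _ iK; rewrite !mE; lra.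
- by have := @triangle_ge f g (g x0 - f x0) (- 1) 1 _ _ _ _ iK; rewrite !mE; lra.
- by have := @triangle_ge f g (f x0 - g x0) 1 (- 1) _ _ _ _ iK; rewrite !mE; lra.
- by have := @triangle_ge f g (f x0 - g x0) 1 (- 1) _ _ _ _ iK; rewrite !mE; lra.
- by have := @triangle_ge f g (g x0 - f x0) (- 1) 1 _ _ _ _ iK; rewrite !mE; lra.
- by have := @triangle_ge f g (g x0 - f x0) (- 1) 1 _ _ _ _ iK; rewrite !mE; lra.
- by have := @triangle_ge f g (f x0 - g x0) 1 (- 1) _ _ _ _ iK; rewrite !mE; lra.
- by have := @triangle_ge f g (f x0 - g x0) 1 (- 1) _ _ _ _ iK; rewrite !mE; lra.
Qed.

Variables (t n : 'I_3 -> 'rV[R]_2).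

Lemma continuous_at_star vs a (l : seq 'I_4) i0 (u : pwpoly R) :
  (forall i, K x0 x1 x2 i a -> i \in i0 :: l) ->
  (forall i, i \in l -> eval_at (pder vs (u i0)) a = eval_at (pder vs (u i)) a) ->
  continuous_at x0 x1 x2 vs a u.
Proof.
move=> Kl ul i j /Kl i_l /Kl j_l.
have E k : k \in i0 :: l -> eval_at (pder vs (u k)) a = eval_at (pder vs (u i0)) a.
  by rewrite inE => /predU1P[-> //|/ul].
by rewrite !E.
Qed.

Lemma forall_mem_cat (T : eqType) (s1 s2 : seq T) (P : T -> Prop) :
  (forall z, z \in s1 ++ s2 -> P z) ->
  (forall z, z \in s1 -> P z) /\ (forall z, z \in s2 -> P z).
Proof. by move=> h; split=> z zs; apply: h; rewrite mem_cat zs ?orbT. Qed.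

(** Four quartics have 60 coefficients, and 33 linear equations on them define
the spline space. *)
Lemma dim_UM_ge27 : (27 <= \dim {:UM x0 x1 x2 t n})%N.
Proof.
pose C := (\bigcap_(phi <- constraints x0 x1 x2 t n) lker phi)%VS.
pose f := linfun (@UM_coefs R x0 x1 x2 t n).
have C27 : (27 <= \dim C)%N.
  have := dim_common_kernel (constraints x0 x1 x2 t n).
  rewrite size_constraints -/C dimvf.
  have -> : dim {ffun 'I_4 * 'X_{1..2 < 5} -> R^o} = (4 * #|{: 'X_{1..2 < 5}}|)%N.
    transitivity (#|{: 'I_4 * 'X_{1..2 < 5}}| * 1)%N => //.
    by rewrite muln1 card_prod card_ord.
  have := card_bmultinom_quartic; lia.
(* Every solution of the equations is the coefficient family of a spline. *)
have CF : (C <= limg f)%VS.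
  apply/subvP => c cC.
  have c0 phi : phi \in constraints x0 x1 x2 t n -> phi c = 0.
    move=> phiC; apply/eqP; rewrite -memv_ker; apply: subvP cC.
    by rewrite /C (big_rem phi) //= capvSl.
  pose u : pwpoly R := [ffun i => piece_of c i].
  have uP : u \in UM_pred x0 x1 x2 t n.
    have [/jumpsP j0 /forall_mem_cat[/jumpsP jm1 /forall_mem_cat[/jumpsP jm2
      /forall_mem_cat[/jumpsP jm3 /forall_mem_cat[/jumpsP jd1 /jumpsP jd3]]]]] :=
      forall_mem_cat c0.
    have star a (pairs : seq ('I_4 * 'I_4)) i0 (l : seq 'I_4)
        (vss : seq (seq 'rV[R]_2)) :
        (forall ij vs, ij \in pairs -> vs \in vss ->
          eval_at (pder vs (piece_of c ij.1)) a =
          eval_at (pder vs (piece_of c ij.2)) a) ->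
        pairs = [seq (i0, i) | i <- l] ->
        (forall i, K x0 x1 x2 i a -> i \in i0 :: l) ->
        {in vss, forall vs, continuous_at x0 x1 x2 vs a u}.
      move=> h pE Kl vs vsP; apply: (continuous_at_star Kl) => i il.
      by rewrite !ffunE; apply: (h (i0, i)) => //; rewrite pE; apply: map_f.
    have only i := node_K_only i.
    apply/UM_predP; split.
    - by move=> i; rewrite ffunE msize_piece_of.
    - by apply: (star _ _ K2 [:: K3] _ j0) => // i; have [[+ _ _] _] := only i.
    - have K4all (i : 'I_4) : i \in [:: K1; K2; K3; K4] by case: i => [[|[|[|[|]]]]].
      move=> k; have [->|->|->] : [\/ k = 0, k = 1 | k = 2%R].
        by case: k => [[|[|[|]]]] // k3;
          [apply: Or31|apply: Or32|apply: Or33]; apply: val_inj.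
      + exact: (star _ _ K1 [:: K2; K3; K4] _ jm1).
      + by apply: (star _ _ K1 [:: K2] _ jm2) => // i; have [[_ + _] _] := only i.
      + by apply: (star _ _ K3 [:: K4] _ jm3) => // i; have [[_ _ +] _] := only i.
    - by apply: (star _ _ K1 [:: K2] _ jd1) => // i; have [_ [+ _]] := only i.
    - by apply: (star _ _ K3 [:: K4] _ jd3) => // i; have [_ [_ +]] := only i.
  apply/memv_imgP; exists (MkUM uP); first exact: memvf.
  rewrite lfunE; apply/ffunP => -[i b]; rewrite !ffunE /=.
  by rewrite mcoeff_piece_of.
apply: leq_trans C27 _; apply: leq_trans (dimvS CF) _.
by rewrite -(limg_ker_dim f fullv) leq_addl.
Qed.

End Geometry.

(** * Edge frames and edge midpoints *)

Section Frames.
Variable R : realType.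
Implicit Types (a b c v w t n m : 'rV[R]_2) (p q : {mpoly R[2]}).

Lemma axis_expand v : v = v 0 0 *: axis R 0 + v 0 1 *: axis R 1.
Proof.
apply/rowP => i; rewrite !mxE /=.
by have [->|->] := ord2P i; rewrite /= ?mulr1 ?mulr0 ?addr0 ?add0r.
Qed.

Ltac jet h := apply: h; rewrite /jet2 /jet1 /= !inE ?eqxx ?orbT.

Lemma zero_jet2_axis p a :
  {in jet2 R, forall vs, eval_at (pder vs p) a = 0} -> zero_jet2 p a.
Proof.
move=> h v w; rewrite [v]axis_expand [w]axis_expand !eval_dird_linl.
rewrite [dird (axis R 0) (dird _ _)]dirdC [dird (axis R 1) (dird _ _)]dirdC.
rewrite !eval_dird_linl.
rewrite [dird (axis R 1) (dird (axis R 0) p)]dirdC.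
have /= e0 : eval_at (pder [::] p) a = 0 by jet h.
have /= e1 : eval_at (pder [:: axis R 0] p) a = 0 by jet h.
have /= e2 : eval_at (pder [:: axis R 1] p) a = 0 by jet h.
have /= e3 : eval_at (pder [:: axis R 0; axis R 0] p) a = 0 by jet h.
have /= e4 : eval_at (pder [:: axis R 0; axis R 1] p) a = 0 by jet h.
have /= e5 : eval_at (pder [:: axis R 1; axis R 1] p) a = 0 by jet h.
by rewrite e0 e1 e2 e3 e4 e5 !(mulr0, addr0).
Qed.

Lemma eq_grad_axis p q a :
  (forall i, eval_at (dird (axis R i) p) a = eval_at (dird (axis R i) q) a) ->
  forall w, eval_at (dird w p) a = eval_at (dird w q) a.
Proof. by move=> h w; rewrite [w]axis_expand !eval_dird_linl !h. Qed.

(** A unit tangent and a unit normal of a plane edge form an orthonormal basis,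
with coordinates given by scalar products. With d the determinant of [t], [n],
orthonormality says that [n] is d times the rotation of [t] by a right angle
and that d^2 = 1. *)
Lemma edge_frame_basis (e : 'rV[R]_2 * 'rV[R]_2) t n : edge_frame e t n ->
  (exists k, e.2 - e.1 = k *: t) /\ (forall w, exists x y, w = x *: t + y *: n).
Proof.
move=> [te tt nn tn]; split.
  have /vlineP[k tE] := te.
  have k0 : k != 0.
    apply: contra_eq_neq tt => k0; rewrite tE k0 scale0r /dot mul0mx mxE.
    by rewrite eq_sym oner_eq0.
  by exists k^-1; rewrite tE scalerA mulVf // scale1r.
move=> w; exists (dot w t), (dot w n).
have dotE v v' : dot v v' = v 0 0 * v' 0 0 + v 0 1 * v' 0 1.
  rewrite /dot mxE !big_ord_recl big_ord0 addr0 !mxE.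
  by congr (_ + v _ _ * v' _ _); apply: val_inj.
move: tt nn tn; rewrite !dotE => tt nn tn.
set t0 := t 0 0 in tt nn tn *; set t1 := t 0 1 in tt nn tn *.
set n0 := n 0 0 in tt nn tn *; set n1 := n 0 1 in tt nn tn *.
pose d := t0 * n1 - t1 * n0.
have dd : d * d = 1.
  have -> : d * d =
      (t0 * t0 + t1 * t1) * (n0 * n0 + n1 * n1) - (t0 * n0 + t1 * n1) ^+ 2.
    by rewrite /d; ring.
  by rewrite tt nn tn; ring.
have n0E : n0 = - t1 * d.
  have -> : - t1 * d = n0 * (t0 * t0 + t1 * t1) - t0 * (t0 * n0 + t1 * n1).
    by rewrite /d; ring.
  by rewrite tt tn; ring.
have n1E : n1 = t0 * d.
  have -> : t0 * d = n1 * (t0 * t0 + t1 * t1) - t1 * (t0 * n0 + t1 * n1).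
    by rewrite /d; ring.
  by rewrite tt tn; ring.
apply/rowP => i; rewrite !mxE -/t0 -/t1 -/n0 -/n1.
have [->|->] := ord2P i; rewrite -/t0 -/t1 -/n0 -/n1 n0E n1E; clearbody d.
  transitivity (w 0 0 * (t0 * t0 + t1 * t1 * (d * d)) +
                w 0 1 * (t0 * t1 * (1 - d * d))).
    by rewrite dd mulr1 tt; ring.
  by ring.
transitivity (w 0 1 * (t1 * t1 + t0 * t0 * (d * d)) +
              w 0 0 * (t0 * t1 * (1 - d * d))).
  by rewrite dd mulr1 (addrC (t1 * t1)) tt; ring.
by ring.
Qed.

Lemma eval_dirdZ x v p a :
  eval_at (dird (x *: v) p) a = x * eval_at (dird v p) a.
Proof. by have := eval_dird_linl x 0 v 0 p a; rewrite scaler0 addr0 mul0r addr0. Qed.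

(** What the degrees of freedom at an edge midpoint provide when they vanish; the
value and the tangential derivative are not among them. *)
Definition midpoint_data_zero p m t n :=
  [/\ eval_at (dird n p) m = 0, eval_at (dird t (dird n p)) m = 0
    & eval_at (dird t (dird t p)) m = 0].

(** The point where the omitted tangential data are recovered. By
[half_edge_slope], the slope at the midpoint is twice the value when the edge is
run from its first end, and minus twice the value when it is run from the other
one. Continuity of both makes them zero. *)
Lemma edge_midpoint_zero p q (e : 'rV[R]_2 * 'rV[R]_2) t n (m := midpoint e.1 e.2) :
  edge_frame e t n ->
  (msize p <= 5)%N -> (msize q <= 5)%N ->
  zero_jet2 p e.1 -> zero_jet2 q e.2 ->
  eval_at p m = eval_at q m ->
  (forall w, eval_at (dird w p) m = eval_at (dird w q) m) ->
  midpoint_data_zero p m t n -> eval_at (dird t (dird t q)) m = 0 ->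
  eval_at p m = 0 /\ forall w, eval_at (dird w p) m = 0.
Proof.
case: e @m => a b /= /edge_frame_basis /= [[c abE] basis] p5 q5 pa qb pq pq1.
move=> [pn ptn ptt] qtt.
set m := midpoint a b in pq pq1 pn ptn ptt qtt *.
pose h := c / 2.
have mE : m = a + h *: t.
  by rewrite /h mulrC -scalerA -abE; apply/rowP => i; rewrite !mxE; field.
have mE' : m = b + - h *: t.
  by rewrite scaleNr /h mulrC -scalerA -abE; apply/rowP => i; rewrite !mxE; field.
have sp := half_edge_slope p5 pa (e := h *: t); rewrite -mE in sp.
have sq := half_edge_slope q5 qb (e := - h *: t); rewrite -mE' in sq.
have dirdZZ x v f y : eval_at (dird (x *: v) (dird (x *: v) f)) y =
    x * (x * eval_at (dird v (dird v f)) y).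
  by rewrite eval_dirdZ dirdC eval_dirdZ.
move: sp sq; rewrite !dirdZZ ptt qtt !mulr0 !eval_dirdZ -pq -pq1.
move=> /(_ erefl) sp /(_ erefl) sq.
have p0 : eval_at p m = 0 by lra.
(* If the edge is reduced to a point, the midpoint is its end. *)
have [c0|c0] := eqVneq c 0.
  rewrite mE /h c0 mul0r scale0r addr0; split=> [|w]; first by have [] := pa a a.
  by have [] := pa w w.
have pt : eval_at (dird t p) m = 0.
  move/eqP: sp; rewrite p0 mulr0 mulf_eq0 => /orP[|/eqP //].
  by rewrite mulf_eq0 invr_eq0 pnatr_eq0 orbF (negPf c0).
split=> // w; have [x [y ->]] := basis w.
by rewrite eval_dird_linl pt pn !mulr0 addr0.
Qed.

Lemma flat_frame p m (e : 'rV[R]_2 * 'rV[R]_2) t n : edge_frame e t n ->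
  eval_at p m = 0 -> (forall w, eval_at (dird w p) m = 0) ->
  midpoint_data_zero p m t n -> flat p m (e.2 - e.1).
Proof.
move=> /edge_frame_basis [[c ->] basis] p0 p1 [_ ptn ptt] w; split=> //.
have [x [y ->]] := basis w.
rewrite eval_dirdZ dirdC eval_dird_linl [dird n (dird t p)]dirdC ptt ptn.
by rewrite !mulr0 addr0 mulr0.
Qed.

End Frames.

(** * Unisolvence *)

Section Main.
Variables (R : realType) (x0 x1 x2 : 'rV[R]_2) (t n : 'I_3 -> 'rV[R]_2).
Hypothesis hM : free [:: x1 - x0; x2 - x0].
Hypothesis htn : forall k : 'I_3, edge_frame (edge x0 x1 x2 k) (t k) (n k).

Lemma size_dofs : size (dofs x0 x1 x2 t n) = 27%N.
Proof.
have sE i k : size (edge_dofs x0 x1 x2 t n i k) = 3%N by exact: size_map.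
have vE : size (vertex_dofs x0 x1 x2 t n) = 18%N by exact: size_allpairs.
have mE : size (midpoint_dofs x0 x1 x2 t n) = 9%N.
  by rewrite /midpoint_dofs size_cat sE size_cat !sE.
by rewrite /dofs size_cat vE mE.
Qed.

Lemma free_frame (v w : 'rV[R]_2) (a b c d : R) :
  free [:: v; w] -> a * d - b * c != 0 ->
  free [:: a *: v + b *: w; c *: v + d *: w].
Proof.
move=> /(@freeP _ _ _ [tuple v; w]) vw det.
apply/(@freeP _ _ _ [tuple a *: v + b *: w; c *: v + d *: w]) => k.
rewrite !big_ord_recl big_ord0 addr0 /= => e.
pose k0 := k ord0; pose k1 := k (lift ord0 ord0).
have := vw (fun i => if i == 0 then k0 * a + k1 * c else k0 * b + k1 * d).
rewrite !big_ord_recl big_ord0 addr0 /= => /(_ _).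
have {}e : (k0 * a + k1 * c) *: v + (k0 * b + k1 * d) *: w = 0.
  by rewrite -e !scalerDr !scalerDl !scalerA addrACA.
move=> /(_ e) h; have /= h0 := h 0; have /= h1 := h 1.
have k00 : k0 = 0.
  apply: (mulfI det); rewrite mulr0.
  have -> : (a * d - b * c) * k0 =
      d * (k0 * a + k1 * c) - c * (k0 * b + k1 * d) by ring.
  by rewrite h0 h1; ring.
have k10 : k1 = 0.
  apply: (mulfI det); rewrite mulr0.
  have -> : (a * d - b * c) * k1 =
      a * (k0 * b + k1 * d) - b * (k0 * a + k1 * c) by ring.
  by rewrite h0 h1; ring.
move=> i; have [->|->] := ord2P i; first exact: k00.
by rewrite -[RHS]k10 /k1; congr (k _); apply: val_inj.
Qed.

Ltac neq := by apply/eqP => *; lra.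
Ltac vec := by apply/rowP => i; rewrite !mxE /=; field.

(** The splines killed by all degrees of freedom are determined piece by piece.
Flatness at the midpoints first makes [K2] and [K3] vanish, by [central_zero]
with the direction of [x1 x2] at [m1]; continuity at [d1] and [d3] then supplies
the last value that [corner_zero] needs on [K1] and [K4]. *)
Lemma dofs_separate (u : UM x0 x1 x2 t n) :
  (forall phi, phi \in dofs x0 x1 x2 t n -> phi u = 0) -> u = 0.
Proof.
move=> u0; pose P := pieces u.
have /forall_mem_cat[v0 /forall_mem_cat[e0 /forall_mem_cat[e1 e2]]] := u0.
have node (i : 'I_4) a vs :
    linfun (node_val i a vs) u = eval_at (pder vs (P i)) a :> R.
  by rewrite lfunE.
have vertex (i : 'I_4) a :
    (i, a) \in [:: (K2, x0); (K1, x1); (K4, x2)] -> zero_jet2 (P i) a.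
  move=> ia; apply: zero_jet2_axis => vs vsJ; rewrite -node; apply: v0.
  by apply/allpairsP; exists ((i, a), vs).
have edge_dofs_data (i : 'I_4) k :
    (forall phi, phi \in edge_dofs x0 x1 x2 t n i k -> phi u = 0) ->
    midpoint_data_zero (P i) (emid x0 x1 x2 k) (t k) (n k).
  move=> h; have h' vs : vs \in [:: [:: n k]; [:: t k; n k]; [:: t k; t k]] ->
      eval_at (pder vs (P i)) (emid x0 x1 x2 k) = 0.
    by move=> vsE; rewrite -node; apply: h; apply/mapP; exists vs.
  by split; [apply: (h' [:: n k]) | apply: (h' [:: t k; n k])
            | apply: (h' [:: t k; t k])]; rewrite !inE eqxx ?orbT.
have [P5 Px0 Pm Pd1 Pd3] := UMP u.
have [[Kx0 Km1 Km2 Km3] [Kd1 Kd3]] := nodes_in_K x0 x1 x2.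
(* [ia] and [ib] are the pieces meeting the two halves of the edge, [i0] the one
   on which its degrees of freedom are read; continuity spreads the conclusion to
   all pieces around the midpoint. *)
have flatP k (ia ib i0 i : 'I_4) :
    K x0 x1 x2 ia (emid x0 x1 x2 k) -> K x0 x1 x2 ib (emid x0 x1 x2 k) ->
    K x0 x1 x2 i0 (emid x0 x1 x2 k) -> K x0 x1 x2 i (emid x0 x1 x2 k) ->
    zero_jet2 (P ia) (edge x0 x1 x2 k).1 -> zero_jet2 (P ib) (edge x0 x1 x2 k).2 ->
    midpoint_data_zero (P i0) (emid x0 x1 x2 k) (t k) (n k) ->
    flat (P i) (emid x0 x1 x2 k) ((edge x0 x1 x2 k).2 - (edge x0 x1 x2 k).1).
  set m := emid x0 x1 x2 k => Kia Kib Ki0 Ki Pia Pib P0.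
  have grad j l : K x0 x1 x2 j m -> K x0 x1 x2 l m ->
      forall w, eval_at (dird w (P j)) m = eval_at (dird w (P l)) m.
    move=> Kj Kl; apply: eq_grad_axis => d.
    have [->|->] := ord2P d.
      by apply: (Pm k [:: axis R 0]); rewrite // /jet1 !inE eqxx ?orbT.
    by apply: (Pm k [:: axis R 1]); rewrite // /jet1 !inE eqxx ?orbT.
  have val j l : K x0 x1 x2 j m -> K x0 x1 x2 l m ->
      eval_at (P j) m = eval_at (P l) m.
    by move=> Kj Kl; apply: (Pm k [::]); rewrite // /jet1 !inE eqxx ?orbT.
  have frame j : K x0 x1 x2 j m -> midpoint_data_zero (P j) m (t k) (n k).
    move=> Kj; have [Pn Ptn Ptt] := P0; split.
    - by rewrite (grad j i0).
    - rewrite -Ptn; apply: (Pm k [:: t k; n k]) => //.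
      by rewrite mem_cat !inE eqxx ?orbT.
    - rewrite -Ptt; apply: (Pm k [:: t k; t k]) => //.
      by rewrite mem_cat !inE eqxx ?orbT.
  have [_ _ Ptt] := frame ib Kib.
  have [z0 z1] := edge_midpoint_zero (htn k) (P5 ia) (P5 ib) Pia Pib
    (val _ _ Kia Kib) (grad _ _ Kia Kib) (frame _ Kia) Ptt.
  apply: (flat_frame (htn k)) (frame _ Ki); first by rewrite (val i ia).
  by move=> w; rewrite (grad i ia).
have V2 : zero_jet2 (P K2) x0 by apply: vertex; rewrite !inE eqxx ?orbT.
have V1 : zero_jet2 (P K1) x1 by apply: vertex; rewrite !inE eqxx ?orbT.
have V4 : zero_jet2 (P K4) x2 by apply: vertex; rewrite !inE eqxx ?orbT.
have V3 : zero_jet2 (P K3) x0.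
  apply: zero_jet2_axis => vs vsJ.
  transitivity (eval_at (pder vs (P K2)) x0).
    by apply: (Px0 vs vsJ); [apply: (Kx0 K3) | apply: (Kx0 K2)];
      rewrite !inE eqxx ?orbT.
  rewrite -node; apply: v0; apply/allpairsP; exists ((K2, x0), vs).
  by split=> //=; rewrite inE eqxx.
have F1 i : flat (P i) (m1 x0 x1 x2) (x2 - x1).
  by apply: (flatP (@Ordinal 3 0 isT) K1 K4 K1) => //; exact: (edge_dofs_data _ _ e0).
have F2 i : i \in [:: K1; K2] -> flat (P i) (m2 x0 x1 x2) (x1 - x0).
  move=> /Km2 Ki; apply: (flatP (@Ordinal 3 1 isT) K2 K1 K1) => //;
    try (by first [apply: (Km2 K1)|apply: (Km2 K2)]; rewrite !inE eqxx ?orbT).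
  exact: (edge_dofs_data _ _ e1).
have F3 i : i \in [:: K3; K4] -> flat (P i) (m3 x0 x1 x2) (x2 - x0).
  move=> /Km3 Ki; apply: (flatP (@Ordinal 3 2 isT) K3 K4 K3) => //;
    try (by first [apply: (Km3 K3)|apply: (Km3 K4)]; rewrite !inE eqxx ?orbT).
  exact: (edge_dofs_data _ _ e2).
have flatZ (p : {mpoly R[2]}) m e c e' : flat p m e -> e' = c *: e -> flat p m e'.
  by move=> h -> w; have [h0 h1 h2] := h w; split; rewrite // eval_dirdZ h2 mulr0.
pose v := x1 - x0; pose w := x2 - x0.
have frame2 a b c d y z : y = a *: v + b *: w -> z = c *: v + d *: w ->
    a * d - b * c != 0 -> free [:: y; z] by move=> -> ->; apply: free_frame.
(* x2 - x1 = - 4 (m2 - x0) + 2 (m1 - x0) *)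
have P2 : P K2 = 0.
  apply: (@central_zero R (P K2) x0 (m2 x0 x1 x2) (m1 x0 x1 x2) (- 4) 2 _ _ _ V2).
  - exact: P5.
  - apply: (frame2 2^-1 0 2^-1 2^-1); [vec|vec|neq].
  - neq.
  - by apply: (flatZ _ _ _ 2^-1 _ (F2 K2 _)); [rewrite !inE eqxx|vec].
  - by apply: (flatZ _ _ _ 1 _ (F1 K2)); vec.
(* x2 - x1 = 4 (m3 - x0) - 2 (m1 - x0) *)
have P3 : P K3 = 0.
  apply: (@central_zero R (P K3) x0 (m3 x0 x1 x2) (m1 x0 x1 x2) 4 (- 2) _ _ _ V3).
  - exact: P5.
  - apply: (frame2 0 2^-1 2^-1 2^-1); [vec|vec|neq].
  - neq.
  - by apply: (flatZ _ _ _ 2^-1 _ (F3 K3 _)); [rewrite !inE eqxx|vec].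
  - by apply: (flatZ _ _ _ 1 _ (F1 K3)); vec.
have P1 : P K1 = 0.
  apply: (@corner_zero R (P K1) x1 (m1 x0 x1 x2) (m2 x0 x1 x2) _ _ V1).
  - exact: P5.
  - apply: (frame2 (- 2^-1) 2^-1 (- 2^-1) 0); [vec|vec|neq].
  - by apply: (flatZ _ _ _ 2^-1 _ (F1 K1)); vec.
  - by apply: (flatZ _ _ _ (- 2^-1) _ (F2 K1 _)); [rewrite !inE eqxx|vec].
  - transitivity (eval_at (P K2) (d1 x0 x1 x2)); last by rewrite P2 /eval_at meval0.
    by apply: Pd1; [apply: (Kd1 K1)|apply: (Kd1 K2)]; rewrite !inE eqxx ?orbT.
have P4 : P K4 = 0.
  apply: (@corner_zero R (P K4) x2 (m1 x0 x1 x2) (m3 x0 x1 x2) _ _ V4).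
  - exact: P5.
  - apply: (frame2 2^-1 (- 2^-1) 0 (- 2^-1)); [vec|vec|neq].
  - by apply: (flatZ _ _ _ (- 2^-1) _ (F1 K4)); vec.
  - by apply: (flatZ _ _ _ (- 2^-1) _ (F3 K4 _)); [rewrite !inE eqxx ?orbT|vec].
  - transitivity (eval_at (P K3) (d3 x0 x1 x2)); last by rewrite P3 /eval_at meval0.
    by apply: Pd3; [apply: (Kd3 K4)|apply: (Kd3 K3)]; rewrite !inE eqxx ?orbT.
apply/val_inj/ffunP => i; rewrite ffunE -/P.
by have [->|->|->|->] := K_cases i.
Qed.

End Main.

Theorem theorem4p2 (R : realType) (x0 x1 x2 : 'rV[R]_2)
    (t n : 'I_3 -> 'rV[R]_2)
    (hM : free [:: x1 - x0; x2 - x0])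
    (htn : forall k : 'I_3, edge_frame (edge x0 x1 x2 k) (t k) (n k)) :
  basis_of {:'Hom(UM x0 x1 x2 t n, R^o)}%VS (dofs x0 x1 x2 t n).
Proof.
apply: basis_dual; last exact: dofs_separate.
by rewrite size_dofs dim_UM_ge27.
Qed.
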